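(* Let $n\geq 1$ be an integer and let $R$ be an $n$-semiregular commutative ring. Then: (1) $S^{-1}R$ is $n$-semiregular for each multiplicative subset $S$ of $R$; (2) $R/I$ is $n$-semiregular for each pure ideal $I$ of $R$.
   Context: All rings are commutative with identity and all modules are unitary. An $R$-module $M$ is $n$-periodic if there is an exact sequence $0\to M\to P_n\to\cdots\to P_1\to M\to 0$ with all $P_i$ projective. $R$ is $n$-semiregular if every finitely presented $R$-module is $n$-periodic. An ideal $I$ is pure if it is a pure submodule of $R$, i.e. $0\to I\to R\to R/I\to 0$ remains exact after tensoring with any $R$-module (equivalently, $R/I$ is flat over $R$). *)

(* Defs.v *)
From HB Require Import structures.
From mathcomp Require Import all_boot all_order all_algebra.
From mathcomp Require Import boolp ring.

Set Implicit Arguments.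
Unset Strict Implicit.
Unset Printing Implicit Defensive.

Import GRing.Theory.
Import Quotient.

Local Open Scope ring_scope.
Local Open Scope quotient_scope.

(* Rings are comPzRingType, not comNzRingType: localizations and quotients    *)
(* may be the zero ring. Multiplicative subsets and ideals are MathComp's     *)
(* mulrClosed and submodClosed predicates; as choice and excluded middle are  *)
(* assumed (boolp), every subset of R is given by such a boolean predicate.   *)

Section Modules.
Variable R : comPzRingType.

Definition surj (A B : lmodType R) (f : {linear A -> B}) : Prop :=
  forall y, exists x, f x = y.

Definition exact (A B C : lmodType R)
    (f : {linear A -> B}) (g : {linear B -> C}) : Prop :=
  forall y, g y = 0 <-> exists x, f x = y.

Definition short_exact (A B C : lmodType R)
    (f : {linear A -> B}) (g : {linear B -> C}) : Prop :=
  [/\ injective f, exact f g & surj g].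

Definition projective (P : lmodType R) : Prop :=
  forall (A B : lmodType R) (p : {linear A -> B}) (f : {linear P -> B}),
    surj p -> exists g : {linear P -> A}, forall x, p (g x) = f x.

Definition finitely_presented (M : lmodType R) : Prop :=
  exists (m n : nat) (f : {linear 'rV[R]_m -> 'rV[R]_n})
         (g : {linear 'rV[R]_n -> M}), exact f g /\ surj g.

(* proj_exact n A f, for f : B -> C, asserts that there is an exact sequence  *)
(*   0 -> A -> P_n -> ... -> P_1 -> B -f-> C                                  *)
(* with every P_i projective (exactness at C is not required).                *)
(* The sequence is extended to the left, starting from P_1.                   *)
Inductive proj_exact (A : lmodType R) :
    nat -> forall B C : lmodType R, {linear B -> C} -> Prop :=
| ProjExact0 (B C : lmodType R) (f : {linear B -> C}) (i : {linear A -> B}) :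
    injective i -> exact i f -> proj_exact A 0 f
| ProjExactS n (P B C : lmodType R)
    (f : {linear B -> C}) (g : {linear P -> B}) :
    projective P -> exact g f -> proj_exact A n g -> proj_exact A n.+1 f.

(* 0 -> M -> P_n -> ... -> P_1 -> M -> 0, with 'rV_0 as the zero module.      *)
Definition periodic (n : nat) (M : lmodType R) : Prop :=
  proj_exact M n (\0 : {linear M -> 'rV[R]_0}).

Definition semiregular (n : nat) : Prop :=
  forall M : lmodType R, finitely_presented M -> periodic n M.

End Modules.

Section Submodule.
Variables (R : comPzRingType) (V : lmodType R) (W : submodClosed V).

Record submod := SubMod { submod_val : V; _ : submod_val \in W }.

HB.instance Definition _ := [isSub for submod_val].
HB.instance Definition _ := [Choice of submod by <:].
HB.instance Definition _ := [SubChoice_isSubLmodule of submod by <:].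

Definition submod_incl : {linear submod -> V} := \val.

(* submodClosed is stated over semirings, so it does not inherit from         *)
(* zmodClosed, which MathComp's {quot _} expects.                             *)
Definition submod_pred : {pred V} := fun x => x \in W.

Fact submod_pred_closed : zmod_closed submod_pred.
Proof. exact: GRing.submod_closedB (submodClosedP W). Qed.

HB.instance Definition _ := GRing.isZmodClosed.Build V submod_pred submod_pred_closed.

Definition quotmod := {quot (submod_pred : zmodClosed V)}.

HB.instance Definition _ := GRing.Zmodule.on quotmod.
HB.instance Definition _ := Quotient.on quotmod.

Definition quot_class (x : V) : quotmod := \pi_quotmod x.

Lemma quot_classK (x : quotmod) : quot_class (repr x) = x.
Proof. exact: reprK. Qed.

Lemma quot_classP (x y : V) : quot_class x = quot_class y <-> x - y \in W.
Proof. by rewrite (rwP eqP) -(idealrBE (submod_pred : zmodClosed V)). Qed.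

Fact quot_classD : {morph quot_class : x y / x + y}.
Proof. by move=> x y; rewrite /quot_class piE. Qed.

Definition quot_scale (a : R) (x : quotmod) : quotmod :=
  quot_class (a *: repr x).

Lemma quot_scale_class a (x : V) :
  quot_scale a (quot_class x) = quot_class (a *: x).
Proof.
by apply/quot_classP; rewrite -scalerBr rpredZ //; apply/quot_classP;
  rewrite quot_classK.
Qed.

Fact quot_scaleA a b x : quot_scale a (quot_scale b x) = quot_scale (a * b) x.
Proof. by rewrite -[x]quot_classK !quot_scale_class scalerA. Qed.

Fact quot_scale1 : left_id 1 quot_scale.
Proof. by move=> x; rewrite -[x]quot_classK quot_scale_class scale1r. Qed.

Fact quot_scaleDr : right_distributive quot_scale +%R.
Proof.
move=> a x y; rewrite -[x]quot_classK -[y]quot_classK -quot_classD.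
by rewrite !quot_scale_class scalerDr quot_classD.
Qed.

Fact quot_scaleDl x : {morph quot_scale^~ x : a b / a + b}.
Proof.
by move=> a b; rewrite -[x]quot_classK !quot_scale_class scalerDl quot_classD.
Qed.

HB.instance Definition _ := GRing.Zmodule_isLmodule.Build R quotmod
  quot_scaleA quot_scale1 quot_scaleDr quot_scaleDl.

Fact quot_class_linear : linear quot_class.
Proof.
by move=> a x y; rewrite quot_classD -quot_scale_class.
Qed.

HB.instance Definition _ :=
  GRing.isLinear.Build R V quotmod *:%R quot_class quot_class_linear.

Definition quot_proj : {linear V -> quotmod} := quot_class.

End Submodule.

(* An ideal of R is a submodule of the R-module R^o.                          *)
Section IdealQuotient.
Variables (R : comPzRingType) (I : submodClosed R^o).
Implicit Types x y z : quotmod I.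

Definition quot_one : quotmod I := quot_class I 1.
Definition quot_mul x y : quotmod I := quot_class I (repr x * repr y).

Lemma quot_mul_class (a b : R^o) :
  quot_mul (quot_class I a) (quot_class I b) = quot_class I (a * b).
Proof.
rewrite /quot_mul; set a' := repr _; set b' := repr _; apply/quot_classP.
have ha : a' - a \in I by apply/quot_classP; rewrite quot_classK.
have hb : b' - b \in I by apply/quot_classP; rewrite quot_classK.
have -> : a' * b' - a * b = (a' : R) *: (b' - b) + (b : R) *: (a' - a) :> R^o.
  by rewrite !scalerBr [b *: a]mulrC [b *: a']mulrC addrA subrK.
by rewrite rpredD // rpredZ.
Qed.

Fact quot_mulA : associative quot_mul.
Proof.
move=> x y z; rewrite -[x]quot_classK -[y]quot_classK -[z]quot_classK.
by rewrite !quot_mul_class mulrA.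
Qed.

Fact quot_mulC : commutative quot_mul.
Proof. by move=> x y; rewrite /quot_mul mulrC. Qed.

Fact quot_mul1 : left_id quot_one quot_mul.
Proof. by move=> x; rewrite -[x]quot_classK quot_mul_class mul1r. Qed.

Fact quot_mulDl : left_distributive quot_mul +%R.
Proof.
move=> x y z; rewrite -[x]quot_classK -[y]quot_classK -[z]quot_classK.
by rewrite -quot_classD !quot_mul_class mulrDl quot_classD.
Qed.

HB.instance Definition _ := GRing.Zmodule_isComPzRing.Build (quotmod I)
  quot_mulA quot_mulC quot_mul1 quot_mulDl.

End IdealQuotient.

Section Tensor.
Variables (R : comPzRingType) (M N : lmodType R).

Definition bilinear_map (P : lmodType R) (f : M -> N -> P) : Prop :=
  (forall y, linear (f^~ y)) /\ (forall x, linear (f x)).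

Definition formal_eval (P : lmodType R) (f : M -> N -> P)
    (s : seq (M * N)) : P :=
  \sum_(p <- s) f p.1 p.2.

(* M (x) N is the set of formal sums of pairs, i.e. lists, two sums being     *)
(* identified when all bilinear maps out of M x N agree on them. No scalar    *)
(* coefficients are needed as a (x, y) is (a x, y). That this is the tensor   *)
(* product is the universal property, tensor_lift_pure and                    *)
(* tensor_lift_unique below.                                                  *)
Definition tensor_eq (s t : seq (M * N)) : bool :=
  `[< forall (P : lmodType R) (f : M -> N -> P), bilinear_map f ->
        formal_eval f s = formal_eval f t >].

Fact tensor_eq_equiv : equiv_class_of tensor_eq.
Proof.
split=> [s|s t|t s u]; first exact/asboolP.
- by apply/asboolP/asboolP => h P f /h.
- by move=> /asboolP h1 /asboolP h2; apply/asboolP => P f hf; rewrite h1 ?h2.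
Qed.

Canonical tensor_equiv := EquivRelPack tensor_eq_equiv.
Canonical tensor_encModRel := defaultEncModRel tensor_eq.

Definition tensor := {eq_quot tensor_eq}.

HB.instance Definition _ : EqQuotient _ tensor_eq tensor :=
  EqQuotient.on tensor.
HB.instance Definition _ := Choice.on tensor.

Definition tclass (s : seq (M * N)) : tensor := \pi_tensor s.

Lemma tclassP s t :
  tclass s = tclass t <->
  forall (P : lmodType R) (f : M -> N -> P), bilinear_map f ->
    formal_eval f s = formal_eval f t.
Proof.
split=> [/eqP|h]; first by rewrite eqmodE => /asboolP.
by apply/eqP; rewrite eqmodE; apply/asboolP.
Qed.

Lemma tclassK (x : tensor) : tclass (repr x) = x.
Proof. exact: reprK. Qed.

Definition scale_formal (a : R) (s : seq (M * N)) : seq (M * N) :=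
  [seq (a *: p.1, p.2) | p <- s].

Lemma formal_eval_cat (P : lmodType R) (f : M -> N -> P) s t :
  formal_eval f (s ++ t) = formal_eval f s + formal_eval f t.
Proof. exact: big_cat. Qed.

Lemma formal_eval_scale (P : lmodType R) (f : M -> N -> P) a s :
  bilinear_map f -> formal_eval f (scale_formal a s) = a *: formal_eval f s.
Proof.
move=> [fl _]; rewrite /formal_eval big_map scaler_sumr.
apply: eq_bigr => -[x y] _ /=.
have f0 : f 0 y = 0.
  by have := fl y (-1) 0 0; rewrite scaler0 add0r scaleN1r addNr.
by have := fl y a x 0; rewrite !addr0 f0 addr0.
Qed.

Definition tensor_zero : tensor := tclass [::].
Definition tensor_add (x y : tensor) : tensor := tclass (repr x ++ repr y).
Definition tensor_scale (a : R) (x : tensor) : tensor :=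
  tclass (scale_formal a (repr x)).
Definition tensor_opp : tensor -> tensor := tensor_scale (-1).

Lemma tclassD s t : tensor_add (tclass s) (tclass t) = tclass (s ++ t).
Proof.
apply/tclassP => P f fP; rewrite !formal_eval_cat.
by congr (_ + _); apply: (tclassP _ _).1 fP; rewrite tclassK.
Qed.

Lemma tclassZ a s : tensor_scale a (tclass s) = tclass (scale_formal a s).
Proof.
apply/tclassP => P f fP; rewrite !formal_eval_scale //.
by congr (_ *: _); apply: (tclassP _ _).1 fP; rewrite tclassK.
Qed.

Fact tensor_addA : associative tensor_add.
Proof.
move=> x y z; rewrite -[x]tclassK -[y]tclassK -[z]tclassK.
by rewrite !tclassD catA.
Qed.

Fact tensor_addC : commutative tensor_add.
Proof.
by move=> x y; apply/tclassP => P f _; rewrite !formal_eval_cat addrC.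
Qed.

Fact tensor_add0 : left_id tensor_zero tensor_add.
Proof. by move=> x; rewrite -[x]tclassK tclassD. Qed.

Fact tensor_addN : left_inverse tensor_zero tensor_opp tensor_add.
Proof.
move=> x; rewrite -[x]tclassK /tensor_opp tclassZ tclassD.
apply/tclassP => P f fP.
by rewrite formal_eval_cat formal_eval_scale // scaleN1r addNr
           /formal_eval big_nil.
Qed.

HB.instance Definition _ := GRing.isZmodule.Build tensor
  tensor_addA tensor_addC tensor_add0 tensor_addN.

Lemma tclass_cat s t : tclass s + tclass t = tclass (s ++ t).
Proof. exact: tclassD. Qed.

Fact tensor_scaleA a b x :
  tensor_scale a (tensor_scale b x) = tensor_scale (a * b) x.
Proof.
rewrite -[x]tclassK !tclassZ; apply/tclassP => P f fP.
by rewrite !formal_eval_scale // scalerA.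
Qed.

Fact tensor_scale1 : left_id 1 tensor_scale.
Proof.
move=> x; rewrite -[x]tclassK !tclassZ; apply/tclassP => P f fP.
by rewrite !formal_eval_scale // scale1r.
Qed.

Fact tensor_scaleDr : right_distributive tensor_scale +%R.
Proof.
move=> a x y; rewrite -[x]tclassK -[y]tclassK tclass_cat !tclassZ tclass_cat.
apply/tclassP => P f fP.
by rewrite formal_eval_scale // !formal_eval_cat !formal_eval_scale // scalerDr.
Qed.

Fact tensor_scaleDl x : {morph tensor_scale^~ x : a b / a + b}.
Proof.
move=> a b; rewrite -[x]tclassK !tclassZ tclass_cat; apply/tclassP => P f fP.
by rewrite formal_eval_cat !formal_eval_scale // scalerDl.
Qed.

HB.instance Definition _ := GRing.Zmodule_isLmodule.Build R tensor
  tensor_scaleA tensor_scale1 tensor_scaleDr tensor_scaleDl.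

Lemma tclass_scale a s : a *: tclass s = tclass (scale_formal a s).
Proof. exact: tclassZ. Qed.

Definition tpure (x : M) (y : N) : tensor := tclass [:: (x, y)].

Lemma tpure_bilinear : bilinear_map tpure.
Proof.
split=> [y a x x'|x a y y']; rewrite tclass_scale tclass_cat;
  apply/tclassP => P f fP; rewrite formal_eval_cat formal_eval_scale //;
  by rewrite /formal_eval !big_seq1 /= (fP.1, fP.2).
Qed.

Lemma tclass_sum s : tclass s = \sum_(p <- s) tpure p.1 p.2.
Proof.
elim: s => [|[x y] s IHs]; first by rewrite big_nil.
by rewrite big_cons -IHs /= tclass_cat.
Qed.

Section Lift.
Variables (P : lmodType R) (f : M -> N -> P) (fP : bilinear_map f).

Definition tensor_lift_fun of bilinear_map f :=
  fun x : tensor => formal_eval f (repr x).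

Lemma tensor_lift_class s : tensor_lift_fun fP (tclass s) = formal_eval f s.
Proof. by apply: (tclassP _ _).1 fP; rewrite tclassK. Qed.

Fact tensor_lift_linear : linear (tensor_lift_fun fP).
Proof.
move=> a x y; rewrite -[x]tclassK -[y]tclassK tclass_scale.
rewrite tclass_cat !tensor_lift_class.
by rewrite formal_eval_cat formal_eval_scale.
Qed.

HB.instance Definition _ := GRing.isLinear.Build R tensor P *:%R
  (tensor_lift_fun fP) tensor_lift_linear.

Definition tensor_lift : {linear tensor -> P} := tensor_lift_fun fP.

Lemma tensor_lift_pure x y : tensor_lift (tpure x y) = f x y.
Proof. by rewrite [LHS]tensor_lift_class /formal_eval big_seq1. Qed.

Lemma tensor_lift_unique (g : {linear tensor -> P}) :
  (forall x y, g (tpure x y) = f x y) -> g =1 tensor_lift.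
Proof.
move=> gE x; rewrite -[x]tclassK tclass_sum !linear_sum.
by apply: eq_bigr => p _; rewrite gE tensor_lift_pure.
Qed.

End Lift.
End Tensor.

Section TensorMap.
Variables (R : comPzRingType) (M M' N : lmodType R) (f : {linear M -> M'}).

Fact tensor_map_bilinear : bilinear_map (fun (x : M) (y : N) => tpure (f x) y).
Proof.
have [h1 h2] := tpure_bilinear M' N.
by split=> [y a x x'|x a y y']; rewrite ?linearP (h1, h2).
Qed.

Definition tensor_map : {linear tensor M N -> tensor M' N} :=
  tensor_lift tensor_map_bilinear.

End TensorMap.

Definition pure_submodule (R : comPzRingType) (V : lmodType R)
    (W : submodClosed V) : Prop :=
  forall N : lmodType R,
    short_exact (tensor_map N (submod_incl W)) (tensor_map N (quot_proj W)).

Definition pure_ideal (R : comPzRingType) (I : submodClosed R^o) : Prop :=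
  pure_submodule I.

Section Localization.
Variables (R : comPzRingType) (S : mulrClosed R).

Definition loc_pair := (R * {s : R | s \in S})%type.
Implicit Types (p q r : loc_pair) (a b : R) (s t : {s : R | s \in S}).

Definition den1 : {s : R | s \in S} := exist _ 1 (rpred1 S).
Definition denM s t : {s : R | s \in S} :=
  exist _ (sval s * sval t) (rpredM (svalP s) (svalP t)).

Definition frac_eq p q : bool :=
  `[< exists2 u, u \in S & u * (p.1 * sval q.2) = u * (q.1 * sval p.2) >].

Fact frac_eq_equiv : equiv_class_of frac_eq.
Proof.
split=> [p|p q|q p r]; first by apply/asboolP; exists 1; rewrite ?rpred1.
  by apply/asboolP/asboolP => -[u uS e]; exists u.
move=> /asboolP[u uS eu] /asboolP[v vS ev]; apply/asboolP.
exists (u * v * sval q.2); first by rewrite !rpredM ?(svalP q.2).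
transitivity (v * sval r.2 * (u * (p.1 * sval q.2))); first by ring.
rewrite eu; transitivity (u * sval p.2 * (v * (q.1 * sval r.2))); first by ring.
by rewrite ev; ring.
Qed.

Canonical frac_equiv := EquivRelPack frac_eq_equiv.
Canonical frac_encModRel := defaultEncModRel frac_eq.

Definition localization := {eq_quot frac_eq}.

HB.instance Definition _ : EqQuotient _ frac_eq localization :=
  EqQuotient.on localization.
HB.instance Definition _ := Choice.on localization.

Implicit Types x y z : localization.

Definition loc_frac a s : localization := \pi_localization (a, s).

Lemma fracP a s b t :
  loc_frac a s = loc_frac b t <-> exists2 u, u \in S & u * (a * sval t) = u * (b * sval s).
Proof.
split=> [/eqP|h]; first by rewrite eqmodE => /asboolP.
by apply/eqP; rewrite eqmodE; apply/asboolP.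
Qed.

Lemma frac_repr x : loc_frac (repr x).1 (repr x).2 = x.
Proof. by rewrite /loc_frac -surjective_pairing reprK. Qed.

Definition loc_add x y : localization :=
  let p := repr x in let q := repr y in
  loc_frac (p.1 * sval q.2 + q.1 * sval p.2) (denM p.2 q.2).
Definition loc_opp x : localization := loc_frac (- (repr x).1) (repr x).2.
Definition loc_mul x y : localization :=
  let p := repr x in let q := repr y in loc_frac (p.1 * q.1) (denM p.2 q.2).
Definition loc_zero : localization := loc_frac 0 den1.
Definition loc_one : localization := loc_frac 1 den1.

Lemma loc_addE a s b t :
  loc_add (loc_frac a s) (loc_frac b t) = loc_frac (a * sval t + b * sval s) (denM s t).
Proof.
have [u uS eu] := (fracP _ _ _ _).1 (frac_repr (loc_frac a s)).
have [v vS ev] := (fracP _ _ _ _).1 (frac_repr (loc_frac b t)).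
rewrite /loc_add; case: (repr (loc_frac a s)) eu => a' s'; case: (repr (loc_frac b t)) ev => b' t' /= ev eu.
apply/fracP; exists (u * v) => /=; first by rewrite rpredM.
transitivity (v * sval t * sval t' * (u * (a' * sval s))
   + u * sval s * sval s' * (v * (b' * sval t))); first by ring.
by rewrite eu ev; ring.
Qed.

Lemma loc_oppE a s : loc_opp (loc_frac a s) = loc_frac (- a) s.
Proof.
have [u uS eu] := (fracP _ _ _ _).1 (frac_repr (loc_frac a s)).
apply/fracP; exists u => //.
transitivity (- (u * ((repr (loc_frac a s)).1 * sval s))); first by ring.
by rewrite eu; ring.
Qed.

Lemma loc_mulE a s b t :
  loc_mul (loc_frac a s) (loc_frac b t) = loc_frac (a * b) (denM s t).
Proof.
have [u uS eu] := (fracP _ _ _ _).1 (frac_repr (loc_frac a s)).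
have [v vS ev] := (fracP _ _ _ _).1 (frac_repr (loc_frac b t)).
rewrite /loc_mul; case: (repr (loc_frac a s)) eu => a' s'; case: (repr (loc_frac b t)) ev => b' t' /= ev eu.
apply/fracP; exists (u * v) => /=; first by rewrite rpredM.
transitivity ((u * (a' * sval s)) * (v * (b' * sval t))); first by ring.
by rewrite eu ev; ring.
Qed.

Lemma frac_cross a s b t : a * sval t = b * sval s -> loc_frac a s = loc_frac b t.
Proof. by move=> e; apply/fracP; exists 1; rewrite ?rpred1 // e. Qed.

Fact loc_addA : associative loc_add.
Proof.
move=> x y z; rewrite -[x]frac_repr -[y]frac_repr -[z]frac_repr !loc_addE.
by apply: frac_cross => /=; ring.
Qed.

Fact loc_addC : commutative loc_add.
Proof.
move=> x y; rewrite -[x]frac_repr -[y]frac_repr !loc_addE.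
by apply: frac_cross => /=; ring.
Qed.

Fact loc_add0 : left_id loc_zero loc_add.
Proof.
move=> x; rewrite -[x]frac_repr loc_addE.
by apply: frac_cross => /=; ring.
Qed.

Fact loc_addN : left_inverse loc_zero loc_opp loc_add.
Proof.
move=> x; rewrite -[x]frac_repr loc_oppE loc_addE.
by apply: frac_cross => /=; ring.
Qed.

HB.instance Definition _ := GRing.isZmodule.Build localization
  loc_addA loc_addC loc_add0 loc_addN.

Fact loc_mulA : associative loc_mul.
Proof.
move=> x y z; rewrite -[x]frac_repr -[y]frac_repr -[z]frac_repr !loc_mulE.
by apply: frac_cross => /=; ring.
Qed.

Fact loc_mulC : commutative loc_mul.
Proof.
move=> x y; rewrite -[x]frac_repr -[y]frac_repr !loc_mulE.
by apply: frac_cross => /=; ring.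
Qed.

Fact loc_mul1 : left_id loc_one loc_mul.
Proof.
move=> x; rewrite -[x]frac_repr loc_mulE.
by apply: frac_cross => /=; ring.
Qed.

Fact loc_mulDl : left_distributive loc_mul +%R.
Proof.
move=> x y z; rewrite -[x]frac_repr -[y]frac_repr -[z]frac_repr.
rewrite [X in loc_mul X]loc_addE !loc_mulE [RHS]loc_addE.
by apply: frac_cross => /=; ring.
Qed.

HB.instance Definition _ := GRing.Zmodule_isComPzRing.Build localization
  loc_mulA loc_mulC loc_mul1 loc_mulDl.

End Localization.

(* Main.v *)
From HB Require Import structures.
Require Import Defs.
From mathcomp Require Import all_boot all_order all_algebra.
From mathcomp Require Import boolp ring.

Set Implicit Arguments.
Unset Strict Implicit.
Unset Printing Implicit Defensive.

Import GRing.Theory.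

Local Open Scope ring_scope.
Local Open Scope quotient_scope.

(** Both parts are instances of one statement about a ring map phi : R -> R'
    that exhibits R' as the localization of R at a multiplicative subset S, in
    the sense of [ring_localized]: phi inverts S, an element of the kernel is
    killed by an element of S, and every element of R' becomes an image after
    multiplication by some phi s with s in S. This applies to S^-1 R by
    construction. It also applies to R/I for a pure ideal I: tensoring the
    inclusion of I with R/xR shows that each x in I satisfies x = x e for some
    e in I ([pure_ideal_fix]), so 1 - e kills x, and R/I is the localization
    of R at 1 + I, the set of elements mapped to 1 ([quot_map_localized]).

    For such a phi, the localization of an R-module M is characterised by the
    analogous conditions on a map from M to an R'-module
    ([mod_localized]); it is constructed as a module of fractions
    ([mod_localization_exists]) and has a universal property ([loc_extend]).
    Clearing denominators shows that localization preserves exactness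
    ([exact_loc], [injective_loc]), and the universal property shows that it
    preserves projectivity ([projective_loc]). Hence it carries an exact
    sequence 0 -> M -> P_n -> ... -> P_1 -> M -> 0 to one of the same kind
    ([proj_exact_loc]).

    It remains to see that every finitely presented R'-module M' is a
    localization of a finitely presented R-module ([fp_descent]). If M' is the
    cokernel of f' : R'^m -> R'^n, then for some s in S the multiple
    phi s *: f' has its matrix in the image of phi; as phi s is invertible,
    the cokernel of f' does not change, and it is the localization of the
    cokernel of the lifted matrix. *)

(** * Linear maps: bundling, cokernels, factorization *)

Section LinearMaps.
Variable R : comPzRingType.
Implicit Types A B C D : lmodType R.

Lemma linear_bundle A B (f : A -> B) :
  linear f -> exists g : {linear A -> B}, g =1 f.
Proof.
move=> lin_f.
by exists (HB.pack_for {linear A -> B} f (GRing.isLinear.Build R A B *:%R f lin_f)).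
Qed.

Definition linear_range A B (f : {linear A -> B}) : {pred B} :=
  fun y => `[< exists x, f x = y >].

Fact linear_range_closed A B (f : {linear A -> B}) :
  GRing.subsemimod_closed (linear_range f).
Proof.
split; first split.
- by apply/asboolP; exists 0; rewrite linear0.
- move=> _ _ /asboolP[x <-] /asboolP[y <-].
  by apply/asboolP; exists (x + y); rewrite linearD.
- by move=> a _ /asboolP[x <-]; apply/asboolP; exists (a *: x); rewrite linearZ.
Qed.

HB.instance Definition _ A B (f : {linear A -> B}) :=
  GRing.isSubmodClosed.Build R B (linear_range f) (linear_range_closed f).

Lemma cokernel_exists A B (f : {linear A -> B}) :
  exists (C : lmodType R) (q : {linear B -> C}), exact f q /\ surj q.
Proof.
pose W : submodClosed B := linear_range f.
exists (quotmod W), (quot_proj W); split=> [y|y]; last first.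
  by exists (repr y); apply: quot_classK.
suff -> : (quot_proj W y = 0) <-> y \in W by split=> /asboolP.
by rewrite -(linear0 (quot_proj W)) /= (quot_classP W y 0) subr0.
Qed.

Lemma linear_factor A B C D (f : {linear A -> B}) (q : {linear B -> C})
    (h : {linear B -> D}) :
  exact f q -> surj q -> (forall x, h (f x) = 0) ->
  exists k : {linear C -> D}, forall x, k (q x) = h x.
Proof.
move=> ex_fq q_surj hf0; have [r rK] := choice q_surj.
have hq x y : q x = q y -> h x = h y.
  move=> /eqP; rewrite -subr_eq0 -linearB => /eqP/ex_fq[z fz].
  by apply/eqP; rewrite -subr_eq0 -linearB -fz hf0.
have [k kE] : exists k : {linear C -> D}, k =1 h \o r.
  apply: linear_bundle => a x y /=; rewrite -linearP; apply: hq.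
  by rewrite linearP !rK.
by exists k => x; rewrite kE; apply: hq; rewrite rK.
Qed.

End LinearMaps.

(** * Restriction of scalars *)

(** The parameter phi is a phantom: it selects the R-module structure that the
    instances below put on the carrier of N. *)
Definition restr_type (R R' : comPzRingType) (phi : {rmorphism R -> R'})
  (N : lmodType R') : Type := N.

Section Restriction.
Variables (R R' : comPzRingType) (phi : {rmorphism R -> R'}) (N : lmodType R').
Local Notation restr := (restr_type phi).

HB.instance Definition _ := GRing.Zmodule.on (restr N).

Definition restr_scale (a : R) (x : restr N) : restr N :=
  phi a *: (x : N).

Fact restr_scaleA a b x :
  restr_scale a (restr_scale b x) = restr_scale (a * b) x.
Proof. by rewrite /restr_scale scalerA rmorphM. Qed.

Fact restr_scale1 : left_id 1 restr_scale.
Proof. by move=> x; rewrite /restr_scale rmorph1 scale1r. Qed.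

Fact restr_scaleDr : right_distributive restr_scale +%R.
Proof. by move=> a x y; apply: scalerDr. Qed.

Fact restr_scaleDl x : {morph restr_scale^~ x : a b / a + b}.
Proof. by move=> a b; rewrite /restr_scale rmorphD scalerDl. Qed.

HB.instance Definition _ := GRing.Zmodule_isLmodule.Build R (restr N)
  restr_scaleA restr_scale1 restr_scaleDr restr_scaleDl.

Definition restrict_scalars : lmodType R := restr N.

End Restriction.

(** * Modules of fractions *)

Section FractionModule.
Variables (R : comPzRingType) (S : mulrClosed R) (M : lmodType R).

Definition mod_pair := (M * {s : R | s \in S})%type.

(** For the multiplicative subset S, two fractions m/s and m'/t agree exactly
    when some u in S satisfies u t m = u s m'. *)
Definition mod_frac_eq (p q : mod_pair) : bool :=
  `[< exists2 u, u \in S & (u * sval q.2) *: p.1 = (u * sval p.2) *: q.1 >].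

Fact mod_frac_eq_equiv : equiv_class_of mod_frac_eq.
Proof.
split=> [p|p q|q p r]; first by apply/asboolP; exists 1; rewrite ?rpred1.
  by apply/asboolP/asboolP => -[u uS e]; exists u.
move=> /asboolP[u uS eu] /asboolP[v vS ev]; apply/asboolP.
exists (u * v * sval q.2); first by rewrite !rpredM ?(svalP q.2).
transitivity ((v * sval r.2) *: ((u * sval q.2) *: p.1)).
  by rewrite scalerA; congr (_ *: _); ring.
rewrite eu; transitivity ((u * sval p.2) *: ((v * sval r.2) *: q.1)).
  by rewrite !scalerA; congr (_ *: _); ring.
by rewrite ev scalerA; congr (_ *: _); ring.
Qed.

Canonical mod_frac_equiv := EquivRelPack mod_frac_eq_equiv.
Canonical mod_frac_encModRel := defaultEncModRel mod_frac_eq.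

Definition frac_mod := {eq_quot mod_frac_eq}.

HB.instance Definition _ : EqQuotient _ mod_frac_eq frac_mod :=
  EqQuotient.on frac_mod.
HB.instance Definition _ := Choice.on frac_mod.

Implicit Types (x y z : frac_mod) (m : M) (s t : {s : R | s \in S}).

Definition mod_frac m s : frac_mod := \pi_frac_mod (m, s).

Lemma mod_fracP m s m' t :
  mod_frac m s = mod_frac m' t <->
  exists2 u, u \in S & (u * sval t) *: m = (u * sval s) *: m'.
Proof.
split=> [/eqP|h]; first by rewrite eqmodE => /asboolP.
by apply/eqP; rewrite eqmodE; apply/asboolP.
Qed.

Lemma mod_frac_repr x : mod_frac (repr x).1 (repr x).2 = x.
Proof. by rewrite /mod_frac -surjective_pairing reprK. Qed.

Lemma mod_frac_cross m s m' t :
  sval t *: m = sval s *: m' -> mod_frac m s = mod_frac m' t.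
Proof. by move=> e; apply/mod_fracP; exists 1; rewrite ?rpred1 // !mul1r. Qed.

Definition mod_add x y : frac_mod :=
  let p := repr x in let q := repr y in
  mod_frac (sval q.2 *: p.1 + sval p.2 *: q.1) (denM p.2 q.2).
Definition mod_opp x : frac_mod := mod_frac (- (repr x).1) (repr x).2.

Lemma mod_addE m s m' t :
  mod_add (mod_frac m s) (mod_frac m' t) =
  mod_frac (sval t *: m + sval s *: m') (denM s t).
Proof.
have [u uS eu] := (mod_fracP _ _ _ _).1 (mod_frac_repr (mod_frac m s)).
have [v vS ev] := (mod_fracP _ _ _ _).1 (mod_frac_repr (mod_frac m' t)).
rewrite /mod_add; move: eu ev.
case: (repr (mod_frac m s)) => a a'; case: (repr (mod_frac m' t)) => b b' /=.
move=> eu ev; apply/mod_fracP; exists (u * v) => /=; first by rewrite rpredM.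
transitivity ((v * sval t * sval b') *: ((u * sval s) *: a) +
              (u * sval s * sval a') *: ((v * sval t) *: b)).
  by rewrite scalerDr !scalerA; congr (_ *: _ + _ *: _); ring.
by rewrite eu ev scalerDr !scalerA; congr (_ *: _ + _ *: _); ring.
Qed.

Lemma mod_oppE m s : mod_opp (mod_frac m s) = mod_frac (- m) s.
Proof.
have [u uS eu] := (mod_fracP _ _ _ _).1 (mod_frac_repr (mod_frac m s)).
by apply/mod_fracP; exists u => //; rewrite !scalerN eu.
Qed.

Fact mod_addA : associative mod_add.
Proof.
move=> x y z; rewrite -[x]mod_frac_repr -[y]mod_frac_repr -[z]mod_frac_repr.
rewrite !mod_addE; apply: mod_frac_cross => /=.
by rewrite !scalerDr !scalerA addrA; congr (_ *: _ + _ *: _ + _ *: _); ring.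
Qed.

Fact mod_addC : commutative mod_add.
Proof.
move=> x y; rewrite -[x]mod_frac_repr -[y]mod_frac_repr !mod_addE.
by apply: mod_frac_cross => /=; rewrite mulrC addrC.
Qed.

Fact mod_add0 : left_id (mod_frac 0 (den1 S)) mod_add.
Proof.
move=> x; rewrite -[x]mod_frac_repr mod_addE.
by apply: mod_frac_cross => /=; rewrite scaler0 add0r scale1r mul1r.
Qed.

Fact mod_addN : left_inverse (mod_frac 0 (den1 S)) mod_opp mod_add.
Proof.
move=> x; rewrite -[x]mod_frac_repr mod_oppE mod_addE.
by apply: mod_frac_cross => /=; rewrite scalerN addNr !scaler0.
Qed.

HB.instance Definition _ := GRing.isZmodule.Build frac_mod
  mod_addA mod_addC mod_add0 mod_addN.

Lemma mod_fracD m s m' t :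
  mod_frac m s + mod_frac m' t =
  mod_frac (sval t *: m + sval s *: m') (denM s t).
Proof. exact: mod_addE. Qed.

End FractionModule.

(** * Localization along a ring map *)

Section Localization.
Variables (R R' : comPzRingType) (S : mulrClosed R) (phi : {rmorphism R -> R'}).

(** Localizations are characterised by their properties rather than by a
    construction, so that rings such as quotients by pure ideals qualify. *)
Record ring_localized : Prop := RingLocalized {
  loc_unit : forall s, s \in S -> exists u, u * phi s = 1;
  loc_ker : forall a, phi a = 0 -> exists2 s, s \in S & s * a = 0;
  loc_den : forall y, exists2 s, s \in S & exists a, phi s * y = phi a }.

(** Elements of S act bijectively on any R'-module once phi inverts them, so
    only the kernel and the denominators need to be prescribed. *)
Record mod_localized (M : lmodType R) (N : lmodType R')
    (iota : {linear M -> restrict_scalars phi N}) : Prop := ModLocalized {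
  modloc_ker : forall m, iota m = 0 -> exists2 s, s \in S & s *: m = 0;
  modloc_den : forall y, exists2 s, s \in S &
    exists m, phi s *: y = iota m }.

Hypothesis phi_loc : ring_localized.

Lemma loc_eq a b : phi a = phi b -> exists2 s, s \in S & s * a = s * b.
Proof.
move=> /eqP; rewrite -subr_eq0 -rmorphB => /eqP/(loc_ker phi_loc)[s sS e].
by exists s => //; apply/eqP; rewrite -subr_eq0 -mulrBr e.
Qed.

Lemma loc_cancel (N : lmodType R') s (x y : N) :
  s \in S -> phi s *: x = phi s *: y -> x = y.
Proof.
move=> /(loc_unit phi_loc)[u us] e.
by rewrite -[x]scale1r -us -scalerA e scalerA us scale1r.
Qed.

Lemma loc_div (N : lmodType R') s (x : N) :
  s \in S -> exists y, phi s *: y = x.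
Proof.
move=> /(loc_unit phi_loc)[u us].
by exists (u *: x); rewrite scalerA mulrC us scale1r.
Qed.

(** Fractions whose numerators are multiples of the same m can be compared by
    comparing coefficients in R', where S is invertible. This is what reduces
    the module axioms for the R'-action on fractions to identities in R'. *)
Lemma mod_frac_coef (M : lmodType R) (m : M) a b (s t : {s : R | s \in S}) :
  phi (sval t * a) = phi (sval s * b) ->
  mod_frac (a *: m) s = mod_frac (b *: m) t.
Proof.
move=> /loc_eq[u uS e]; apply/mod_fracP; exists u => //.
by rewrite !scalerA -!mulrA e.
Qed.

(** The R'-module is S^-1 M. An element y of R' is a fraction a/s, in the sense
    that phi s * y = phi a, and acts by y (m/t) = (a m)/(s t); the kernel
    condition on phi makes this independent of the choice of a and s. *)
Lemma mod_localization_exists (M : lmodType R) :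
  exists (N : lmodType R') (iota : {linear M -> restrict_scalars phi N}),
    mod_localized iota.
Proof.
pose D := {s : R | s \in S}.
(* nd picks a numerator and a denominator of each element of R'. *)
have [nd ndP] : exists nd : R' -> R * D,
    forall y, phi (sval (nd y).2) * y = phi (nd y).1.
  have h y : exists p : R * D, phi (sval p.2) * y = phi p.1.
    by have [s sS [a e]] := loc_den phi_loc y; exists (a, exist _ s sS).
  by have [nd ndP] := choice h; exists nd.
pose F := frac_mod S M.
pose sc (y : R') (x : F) : F :=
  mod_frac ((nd y).1 *: (repr x).1) (denM (nd y).2 (repr x).2).
have scE y a s (m : M) t : phi (sval s) * y = phi a ->
    sc y (mod_frac m t) = mod_frac (a *: m) (denM s t).
  move=> ya; rewrite /sc.
  have [u uS /=] := (mod_fracP _ _ _ _).1 (mod_frac_repr (mod_frac m t)).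
  case: (repr (mod_frac m t)) => m1 t1 /= eu.
  transitivity (mod_frac ((u * sval t * (nd y).1) *: m1)
      (denM (denM (exist _ u uS) t) (denM (nd y).2 t1))).
    by apply: mod_frac_cross => /=; rewrite !scalerA; congr (_ *: _); ring.
  rewrite [u * sval t * _]mulrC -scalerA eu scalerA.
  apply: mod_frac_coef => /=; rewrite !rmorphM -(ndP y) -ya; ring.
have scA a b x : sc a (sc b x) = sc (a * b) x.
  rewrite -[x]mod_frac_repr; case: (repr x) => m s /=.
  rewrite (scE b _ _ _ _ (ndP b)) (scE a _ _ _ _ (ndP a)).
  rewrite (scE _ _ _ _ _ (ndP (a * b))) scalerA.
  have [[eab ea] eb] := (ndP (a * b), ndP a, ndP b).
  by apply: mod_frac_coef => /=; rewrite !rmorphM -eab -ea -eb; ring.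
have sc1 : left_id 1 sc.
  move=> x; rewrite -[x]mod_frac_repr.
  rewrite (scE 1 1 (den1 S)) ?mulr1 //.
  by apply: mod_frac_cross; rewrite /= scale1r mul1r.
have scDr : right_distributive sc +%R.
  move=> a x y; rewrite -[x]mod_frac_repr -[y]mod_frac_repr mod_fracD.
  rewrite !(scE _ _ _ _ _ (ndP a)) mod_fracD; apply: mod_frac_cross => /=.
  by rewrite !scalerDr !scalerA; congr (_ *: _ + _ *: _); ring.
have scDl x : {morph sc^~ x : a b / a + b}.
  move=> a b; rewrite -[x]mod_frac_repr.
  rewrite !(scE _ _ _ _ _ (ndP _)) mod_fracD !scalerA -scalerDl.
  have [[eab ea] eb] := (ndP (a + b), ndP a, ndP b).
  apply: mod_frac_coef => /=; rewrite !(rmorphM, rmorphD) -eab -ea -eb.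
  by ring.
pose N : lmodType R' := HB.pack_for (lmodType R') F
  (GRing.Zmodule_isLmodule.Build R' F scA sc1 scDr scDl).
pose i (m : M) : restrict_scalars phi N := mod_frac m (den1 S).
have phi1 a : phi (sval (den1 S)) * phi a = phi a.
  by rewrite /= rmorph1 mul1r.
have scN a m s : phi a *: (mod_frac m s : N) = mod_frac (a *: m) s.
  rewrite [LHS](scE _ _ _ _ _ (phi1 a)).
  by apply: mod_frac_cross; rewrite /= mul1r.
have lin_i : linear i.
  move=> a x y; transitivity (mod_frac (a *: x) (den1 S) + mod_frac y (den1 S)).
    rewrite mod_fracD.
    by apply: mod_frac_cross; rewrite /= mul1r !scale1r.
  by congr (_ + _); rewrite -scN.
have [iota iotaE] := linear_bundle lin_i.
exists N, iota; split=> [m|y].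
  rewrite iotaE => /mod_fracP[u uS /=].
  by rewrite !mulr1 scaler0 => um; exists u.
have [[m s] <-] : exists p, mod_frac p.1 p.2 = (y : F).
  by exists (repr (y : F)); apply: mod_frac_repr.
exists (sval s); first exact: (svalP s).
exists m; rewrite iotaE scN /=.
by apply: mod_frac_cross; rewrite /= scale1r.
Qed.


Lemma localized_linearE (M : lmodType R) (N : lmodType R')
    (g : {linear M -> restrict_scalars phi N}) (a : R) (m : M) :
  g (a *: m) = phi a *: (g m : N).
Proof. exact: linearZ. Qed.

(** The universal property. The image z of y is forced by the condition
    phi s *: z = g m whenever phi s *: y = iota m. If y is presented by both
    (s, m) and (t, m'), then t m and s m' agree after multiplication by an
    element of S, so the condition is consistent, as S cancels in A. *)
Lemma loc_extend (M : lmodType R) (N A : lmodType R')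
    (iota : {linear M -> restrict_scalars phi N})
    (g : {linear M -> restrict_scalars phi A}) :
  mod_localized iota ->
  exists g' : {linear N -> A}, forall m, g' (iota m) = g m.
Proof.
move=> iotaP.
have h (y : N) : exists z : A, forall s m,
    s \in S -> phi s *: y = iota m -> phi s *: z = g m.
  have [s sS [m ym]] := modloc_den iotaP y.
  have [z zm] := loc_div (g m : A) sS; exists z => t m' tS ym'.
  have : iota (t *: m) = iota (s *: m').
    by rewrite !localized_linearE -ym -ym' !scalerA mulrC.
  move=> /eqP; rewrite -subr_eq0 -linearB => /eqP.
  move=> /(modloc_ker iotaP)[u uS /eqP].
  rewrite scalerBr subr_eq0 !scalerA => /eqP e.
  apply: (@loc_cancel _ (u * s)); first by rewrite rpredM.
  rewrite -[RHS]localized_linearE -e localized_linearE -zm !scalerA.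
  by congr (_ *: _); rewrite !rmorphM; ring.
have [F FP] := choice h.
have lin_F : linear F.
  move=> a x y.
  have [s sS [m xm]] := modloc_den iotaP x.
  have [t tS [m' ym]] := modloc_den iotaP y.
  have [r rS [b ab]] := loc_den phi_loc a.
  apply: (@loc_cancel _ (r * s * t)); first by rewrite !rpredM.
  rewrite (FP _ _ ((b * t) *: m + (r * s) *: m')) ?rpredM //; last first.
    rewrite [RHS]linearD /= !localized_linearE -xm -ym scalerDr !scalerA.
    by rewrite !rmorphM -ab; congr (_ *: _ + _ *: _); ring.
  rewrite [LHS]linearD /= !localized_linearE -(FP x s m) // -(FP y t m') //.
  rewrite scalerDr !scalerA !rmorphM -ab.
  by congr (_ *: _ + _ *: _); ring.
have [g' g'E] := linear_bundle lin_F; exists g' => m.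
rewrite g'E; have := FP (iota m) 1 m (rpred1 S).
by rewrite rmorph1 !scale1r; apply.
Qed.

Lemma loc_linear_ext (M : lmodType R) (N A : lmodType R')
    (iota : {linear M -> restrict_scalars phi N}) (g h : {linear N -> A}) :
  mod_localized iota -> (forall m, g (iota m) = h (iota m)) -> g =1 h.
Proof.
move=> iotaP gh y; have [s sS [m ym]] := modloc_den iotaP y.
by apply: (loc_cancel sS); rewrite -!linearZ ym gh.
Qed.

(** A lifting problem for Q over R' restricts along iota to one for P over R;
    a solution of the latter extends to Q by the universal property. *)
Lemma projective_loc (P : lmodType R) (Q : lmodType R')
    (iota : {linear P -> restrict_scalars phi Q}) :
  mod_localized iota -> projective P -> projective Q.
Proof.
move=> iotaP projP A B p f p_surj.
have [p' p'E] : exists p' : {linear restrict_scalars phi A ->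
    restrict_scalars phi B}, p' =1 p.
  by apply: linear_bundle => a x y; apply: linearP.
have [f' f'E] : exists f' : {linear P -> restrict_scalars phi B},
    forall x, f' x = f (iota x).
  by apply: linear_bundle => a x y; rewrite linearP; apply: linearP.
have p'_surj : surj p'.
  by move=> y; have [x xy] := p_surj y; exists x; rewrite p'E.
have [g gE] := projP _ _ p' f' p'_surj.
have [g' g'E] := loc_extend g iotaP.
have [pg pgE] : exists h : {linear Q -> B}, forall x, h x = p (g' x).
  by apply: linear_bundle => a x y; rewrite !linearP.
exists g' => x; rewrite -pgE; apply: (loc_linear_ext iotaP) => m.
by rewrite pgE g'E -p'E gE f'E.
Qed.

Section Squares.
Variables (A B C : lmodType R) (A' B' C' : lmodType R').
Variables (f : {linear A -> B}) (g : {linear B -> C}).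
Variables (f' : {linear A' -> B'}) (g' : {linear B' -> C'}).
Variables (iA : {linear A -> restrict_scalars phi A'})
  (iB : {linear B -> restrict_scalars phi B'})
  (iC : {linear C -> restrict_scalars phi C'}).
Hypothesis f'E : forall x, f' (iA x) = iB (f x).
Hypothesis g'E : forall x, g' (iB x) = iC (g x).

(** Injectivity and exactness are both obtained by multiplying an element by
    its denominator and by an annihilator in S, solving the problem over R,
    and dividing in the localization. *)
Lemma injective_loc :
  mod_localized iA -> mod_localized iB -> injective f -> injective f'.
Proof.
move=> iAP iBP inj_f; apply: raddf_inj => x fx0.
have [s sS [a xa]] := modloc_den iAP x.
have /(modloc_ker iBP)[t tS] : iB (f a) = 0.
  by rewrite -f'E -xa linearZ /= fx0 scaler0.
rewrite -linearZ -(linear0 f) => /inj_f ta0.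
apply: (@loc_cancel _ (t * s)); first by rewrite rpredM.
by rewrite scaler0 rmorphM -scalerA xa -localized_linearE ta0 linear0.
Qed.

Lemma exact_loc :
  mod_localized iA -> mod_localized iB -> mod_localized iC ->
  exact f g -> exact f' g'.
Proof.
move=> iAP iBP iCP fg y; split=> [gy0|[x <-]]; last first.
  have [s sS [a xa]] := modloc_den iAP x.
  apply: (loc_cancel sS); rewrite -!linearZ xa f'E g'E scaler0.
  by rewrite (fg (f a)).2 ?linear0 //; exists a.
have [s sS [b yb]] := modloc_den iBP y.
have /(modloc_ker iCP)[t tS] : iC (g b) = 0.
  by rewrite -g'E -yb linearZ /= gy0 scaler0.
rewrite -linearZ => /fg[a fa].
have tsS : t * s \in S by rewrite rpredM.
have [x xa] := loc_div (iA a : A') tsS; exists x; apply: (loc_cancel tsS).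
by rewrite -linearZ xa f'E fa localized_linearE -yb scalerA rmorphM.
Qed.

End Squares.

Lemma induced_map_exists (A B : lmodType R) (A' B' : lmodType R')
    (iA : {linear A -> restrict_scalars phi A'})
    (iB : {linear B -> restrict_scalars phi B'}) (f : {linear A -> B}) :
  mod_localized iA ->
  exists f' : {linear A' -> B'}, forall x, f' (iA x) = iB (f x).
Proof.
move=> iAP.
have [h hE] : exists h : {linear A -> restrict_scalars phi B'},
    forall x, h x = iB (f x).
  by apply: linear_bundle => a x y; rewrite !linearP.
by have [f' f'E] := loc_extend h iAP; exists f' => x; rewrite f'E hE.
Qed.

(** The modules P_i are localized one at a time along the inductive structure
    of the sequence. The localizations of both ends, and of the last map, are
    arbitrary: this is what lets the induction pass from f to g, and what
    allows the same localization of M to be used at both ends. *)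
Lemma proj_exact_loc (A : lmodType R) (A' : lmodType R')
    (iA : {linear A -> restrict_scalars phi A'}) n (B C : lmodType R)
    (f : {linear B -> C}) (B' C' : lmodType R')
    (iB : {linear B -> restrict_scalars phi B'})
    (iC : {linear C -> restrict_scalars phi C'}) (f' : {linear B' -> C'}) :
  mod_localized iA -> mod_localized iB -> mod_localized iC ->
  (forall x, f' (iB x) = iC (f x)) ->
  proj_exact A n f -> proj_exact A' n f'.
Proof.
move=> iAP iBP iCP f'E PE.
elim: PE B' C' iB iC f' iBP iCP f'E => {n B C f}
  [B C f i inj_i ex_if|n P B C f g projP ex_gf _ IHn] B' C' iB iC f' iBP iCP f'E.
  have [i' i'E] := induced_map_exists iB i iAP.
  apply: (@ProjExact0 _ _ _ _ _ i').
    exact: injective_loc i'E iAP iBP inj_i.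
  exact: exact_loc i'E f'E iAP iBP iCP ex_if.
have [P' [iP iPP]] := mod_localization_exists P.
have [g' g'E] := induced_map_exists iB g iPP.
apply: (@ProjExactS _ _ _ P' _ _ _ g').
- exact: projective_loc iPP projP.
- exact: exact_loc g'E f'E iPP iBP iCP ex_gf.
- exact: IHn iPP iBP g'E.
Qed.

Definition map_row n (u : 'rV[R]_n) : restrict_scalars phi 'rV[R']_n :=
  map_mx phi u.

Fact map_row_linear n : linear (@map_row n).
Proof. by move=> a u v; rewrite /map_row map_mxD map_mxZ. Qed.

HB.instance Definition _ n := GRing.isLinear.Build R 'rV[R]_n
  (restrict_scalars phi 'rV[R']_n) *:%R (@map_row n) (@map_row_linear n).

Lemma common_multiple n (s : 'I_n -> R) :
  (forall i, s i \in S) ->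
  exists2 t, t \in S & forall i, exists c, t = c * s i.
Proof.
move=> sS; exists (\prod_i s i) => [|i]; first exact: rpred_prod.
by exists (\prod_(j < n | j != i) s j); rewrite (bigD1 i) //= mulrC.
Qed.

(** Coordinatewise, with a common multiple of the annihilators, respectively
    of the denominators, of the coordinates. *)
Lemma map_row_localized n : mod_localized (@map_row n).
Proof.
split=> [u /rowP u0|y].
  have h i : exists s, s \in S /\ s * u 0 i = 0.
    have [|s sS e] := loc_ker phi_loc (a := u 0 i); last by exists s.
    by have := u0 i; rewrite !mxE.
  have [s sP] := choice h.
  have [t tS tP] := common_multiple (fun i => (sP i).1).
  exists t => //; apply/rowP => i; rewrite !mxE.
  by have [c ->] := tP i; rewrite -mulrA (sP i).2 mulr0.
have h i : exists p : R * R, p.1 \in S /\ phi p.1 * y 0 i = phi p.2.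
  by have [s sS [a e]] := loc_den phi_loc (y 0 i); exists (s, a).
have [p pP] := choice h.
have [t tS tP] := common_multiple (fun i => (pP i).1).
have [c cE] := choice tP.
exists t => //; exists (\row_i (c i * (p i).2)); apply/rowP => i.
by rewrite !mxE [in LHS](cE i) !rmorphM -mulrA (pP i).2.
Qed.

(** The scalar s is a common denominator of the images under f' of the
    standard basis vectors. *)
Lemma clear_denominators m n (f' : {linear 'rV[R']_m -> 'rV[R']_n}) :
  exists2 s, s \in S & exists f : {linear 'rV[R]_m -> 'rV[R]_n},
    forall u, map_row (f u) = phi s *: f' (map_row u).
Proof.
have h (i : 'I_m) : exists p : R * 'rV[R]_n,
    p.1 \in S /\ phi p.1 *: f' 'e_i = map_row p.2.
  have [s sS [v e]] := modloc_den (map_row_localized n) (f' 'e_i).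
  by exists (s, v).
have [p pP] := choice h.
have [s sS sP] := common_multiple (fun i => (pP i).1).
have [c cE] := choice sP.
exists s => //.
have [f fE] : exists f : {linear 'rV[R]_m -> 'rV[R]_n},
    f =1 fun u => \sum_i u 0 i *: (c i *: (p i).2).
  apply: linear_bundle => a u v; rewrite scaler_sumr -big_split.
  by apply: eq_bigr => i _; rewrite !mxE scalerDl !scalerA mulrA.
exists f => u; rewrite fE [map_row u]row_sum_delta !linear_sum.
apply: eq_bigr => i _; rewrite !localized_linearE /= -(pP i).2 !linearZ /= mxE.
rewrite !scalerA [in RHS](cE i) !rmorphM; congr (_ *: _).
by ring.
Qed.

(** M' is the cokernel of some f' : R'^m -> R'^n. With f over R lifting a
    multiple phi s *: f', the cokernel M of f maps to M'. An element of R^n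
    that dies in M' is f' w' over R'; clearing the denominators of w' puts a
    multiple of it by an element of S in the range of f. *)
Lemma fp_descent (M' : lmodType R') :
  finitely_presented M' ->
  exists M : lmodType R, finitely_presented M /\
    exists iota : {linear M -> restrict_scalars phi M'}, mod_localized iota.
Proof.
move=> [m [n [f' [g' [ex_fg' g'_surj]]]]].
have [s sS [f fE]] := clear_denominators f'.
have [M [q [ex_fq q_surj]]] := cokernel_exists f.
have [h hE] : exists h : {linear 'rV[R]_n -> restrict_scalars phi M'},
    forall v, h v = g' (map_row v).
  apply: linear_bundle => a u v.
  by rewrite linearP; apply: linearP.
have hf0 u : h (f u) = 0.
  rewrite hE fE linearZ /= (ex_fg' _).2 ?scaler0 //.
  by exists (map_row u).
have [iota iotaE] := linear_factor ex_fq q_surj hf0.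
exists M; split; first by exists m, n, f, q.
exists iota; split=> [x|y].
  have [v <-] := q_surj x; rewrite iotaE hE => /ex_fg'[w' f'w'].
  have [t tS [u tw']] := modloc_den (map_row_localized m) w'.
  have [|r rS e] := modloc_ker (map_row_localized n) (m := f u - (s * t) *: v).
    rewrite linearB /= fE -tw' linearZ /= f'w' localized_linearE.
    by rewrite scalerA -rmorphM subrr.
  exists (r * (s * t)); first by rewrite !rpredM.
  rewrite -linearZ; apply/ex_fq; exists (r *: u); rewrite linearZ /=.
  by apply/eqP; rewrite -subr_eq0 -scalerA -scalerBr e.
have [w' <-] := g'_surj y.
have [t tS [u tw']] := modloc_den (map_row_localized n) w'.
by exists t => //; exists (q u); rewrite iotaE hE -tw' linearZ.
Qed.

Lemma semiregular_loc n : semiregular R n -> semiregular R' n.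
Proof.
move=> semiregR M' /fp_descent[M [fpM [iota iotaP]]].
apply: (proj_exact_loc iotaP iotaP (map_row_localized 0) _ (semiregR M fpM)).
by move=> x; rewrite /= linear0.
Qed.

End Localization.

(** * The ring of fractions as a localization *)

Section Fractions.
Variables (R : comPzRingType) (S : mulrClosed R).

Definition loc_map (a : R) : localization S := loc_frac a (den1 S).

Fact loc_map_zmod : zmod_morphism loc_map.
Proof.
move=> a b; rewrite /loc_map; symmetry.
transitivity (loc_add (loc_frac a (den1 S)) (loc_opp (loc_frac b (den1 S)))).
  by [].
by rewrite loc_oppE loc_addE; apply: frac_cross => /=; ring.
Qed.

Fact loc_map_monoid : monoid_morphism loc_map.
Proof.
split=> // a b; rewrite [RHS]loc_mulE.
by apply: frac_cross => /=; ring.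
Qed.

HB.instance Definition _ :=
  GRing.isZmodMorphism.Build R (localization S) loc_map loc_map_zmod.
HB.instance Definition _ :=
  GRing.isMonoidMorphism.Build R (localization S) loc_map loc_map_monoid.

Lemma loc_map_localized : ring_localized S loc_map.
Proof.
split=> [s sS|a /fracP[s sS /= e]|y].
- exists (loc_frac 1 (exist _ s sS)); rewrite [LHS]loc_mulE.
  by apply: frac_cross => /=; ring.
- by exists s => //; move: e; rewrite mulr1 mul0r mulr0.
- rewrite -[y]frac_repr; case: (repr y) => a s /=.
  exists (sval s); first exact: (svalP s).
  by exists a; rewrite [LHS]loc_mulE; apply: frac_cross => /=; ring.
Qed.

End Fractions.

(** * The quotient by a pure ideal as a localization *)

Section PureIdeal.
Variables (R : comPzRingType) (I : submodClosed R^o).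

(** For the projection of R onto R/I this is 1 + I. *)
Definition unit_fiber (R' : comPzRingType) (phi : {rmorphism R -> R'}) :
  {pred R} := fun s => phi s == 1.

Fact unit_fiber_closed (R' : comPzRingType) (phi : {rmorphism R -> R'}) :
  GRing.mulr_closed (unit_fiber phi).
Proof.
split=> [|s t /eqP ps /eqP pt]; apply/eqP; first exact: rmorph1.
by rewrite rmorphM ps pt mulr1.
Qed.

HB.instance Definition _ (R' : comPzRingType) (phi : {rmorphism R -> R'}) :=
  GRing.isMulClosed.Build R (unit_fiber phi) (unit_fiber_closed phi).

Definition quot_map (a : R) : quotmod I := quot_class I a.

Fact quot_map_zmod : zmod_morphism quot_map.
Proof. exact: (raddfB (quot_proj I)). Qed.

Fact quot_map_monoid : monoid_morphism quot_map.
Proof. by split=> // a b; rewrite [RHS]quot_mul_class. Qed.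

HB.instance Definition _ :=
  GRing.isZmodMorphism.Build R (quotmod I) quot_map quot_map_zmod.
HB.instance Definition _ :=
  GRing.isMonoidMorphism.Build R (quotmod I) quot_map quot_map_monoid.

Lemma quot_map_eq0 a : quot_map a = 0 <-> a \in I.
Proof. by rewrite -(raddf0 quot_map) (quot_classP I a 0) subr0. Qed.

(** Tensor the inclusion of I into R with R/xR. The element x (x) 1 of
    I (x) R/xR is mapped to 1 (x) x = 0 in R (x) R/xR, so it is 0 by purity.
    The bilinear map b : I x R/xR -> R/xI sending (e, [a]) to [e a] then shows
    that x is 0 in R/xI. *)
Lemma pure_ideal_fix (x : R) :
  pure_ideal I -> x \in I -> exists2 e, e \in I & x = x * e.
Proof.
move=> pureI xI.
(* N = R/xR and Q = R/xI, as cokernels of multiplications by x. *)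
have [xR xRE] : exists f : {linear R^o -> R^o}, forall a : R, f a = x * a.
  by apply: linear_bundle => a b c; rewrite mulrDr /GRing.scale /= mulrCA.
have [xJ xJE] : exists f : {linear submod I -> R^o},
    forall e, f e = x * val e.
  apply: linear_bundle => a b c.
  by rewrite linearP mulrDr /GRing.scale /= mulrCA.
have [N [p [ex_p p_surj]]] := cokernel_exists xR.
have [Q [q [ex_q _]]] := cokernel_exists xJ.
have [r rK] := choice p_surj.
pose b (e : submod I) (y : N) : Q := q (val e * r y).
have q0 (e : submod I) (a : R^o) : p a = 0 -> q (val e * a) = 0.
  move=> /ex_p[c]; rewrite xRE => <-; apply/ex_q.
  by exists ((c : R) *: e); rewrite xJE linearZ /= /GRing.scale /=; ring.
have b_bilin : bilinear_map b.
  split=> [y a e e'|e a y y'].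
    rewrite /b -linearP; congr (q _); rewrite linearP mulrDl.
    by congr (_ + _); rewrite /GRing.scale /= mulrA.
  have : q (val e * (r (a *: y + y') - (a *: r y + r y'))) = 0.
    by apply: q0; rewrite linearB linearP !rK subrr.
  rewrite mulrBr linearB /b => /eqP; rewrite subr_eq0 => /eqP ->.
  rewrite -linearP; congr (q _); rewrite mulrDr.
  by congr (_ + _); rewrite /GRing.scale /= mulrCA.
pose ex : submod I := SubMod xI.
have [inj_t _ _] := pureI N.
have t0 : tpure ex (p 1) = 0.
  apply: inj_t; rewrite linear0 [LHS]tensor_lift_pure.
  have [bl br] := tpure_bilinear R^o N.
  have [L LE] := linear_bundle (bl (p 1)).
  have [L' L'E] := linear_bundle (br (1 : R^o)).
  have -> : submod_incl I ex = x *: (1 : R^o) by rewrite /GRing.scale /= mulr1.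
  rewrite -LE linearZ LE /= -L'E -linearZ -linearZ.
  have /ex_p -> : exists a, xR a = x *: (1 : R^o) by exists 1; apply: xRE.
  by rewrite linear0.
have qx0 : q (x * r (p 1)) = 0.
  by rewrite -[LHS](tensor_lift_pure b_bilin ex (p 1)) t0 linear0.
have /ex_q[e xe] : q x = 0.
  rewrite -[x]mulr1 -[X in x * X](subrK (r (p 1))) mulrDr linearD /= qx0 addr0.
  by apply: (q0 ex); rewrite linearB /= rK subrr.
by exists (val e); [exact: valP | rewrite -xJE].
Qed.

(** An element a of I satisfies a = a e with e in I, so 1 - e kills it and
    lies in 1 + I; the images of 1 + I are 1, hence invertible. *)
Lemma quot_map_localized :
  pure_ideal I -> ring_localized (unit_fiber quot_map) quot_map.
Proof.
move=> pureI; split=> [s /eqP s1|a a0|y].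
- by exists 1; rewrite s1 mulr1.
- have [e eI ae] := pure_ideal_fix pureI ((quot_map_eq0 a).1 a0).
  exists (1 - e); last by rewrite mulrBl mul1r mulrC -ae subrr.
  by apply/eqP; rewrite rmorphB rmorph1 /= (quot_map_eq0 e).2 ?subr0.
- exists 1; first exact: rpred1.
  by exists (repr y); rewrite rmorph1 mul1r; apply/esym/quot_classK.
Qed.

End PureIdeal.

Theorem proposition1p2 (n : nat) (n_ge1 : (1 <= n)%N) (R : comPzRingType)
    (semiregR : semiregular R n) :
  (forall S : mulrClosed R, semiregular (localization S) n) /\
  (forall I : submodClosed R^o, pure_ideal I -> semiregular (quotmod I) n).
Proof.
split=> [S|I pureI].
  exact (semiregular_loc (loc_map_localized S) semiregR).
exact (semiregular_loc (quot_map_localized pureI) semiregR).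
Qed.
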